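(* Consider the meta-linear regression setting of the context, with $\|Q_\gamma\|\le\beta$ with probability 1. For a meta-test task $\gamma$ and arbitrary $\theta\in\mathbb R^p$, let $\tilde\theta_\gamma(\alpha)=\theta-\frac\alpha N\sum_{i=1}^N(x_{\gamma,i}x_{\gamma,i}^\top\theta-x_{\gamma,i}y_{\gamma,i})$ be the parameters obtained by one step of SGD from $\theta$ using $N$ data points $\mathcal O_\gamma=\{(x_{\gamma,i},y_{\gamma,i})\}_{i=1}^N$ of task $\gamma$ and learning rate $\alpha$. Let $S_\gamma(\alpha)=(I-\alpha Q_\gamma)Q_\gamma(I-\alpha Q_\gamma)$ and $$A_\gamma(\alpha)=S_\gamma(\alpha)+\frac{\alpha^2}{N}\Big(\mathbb E[x_{\gamma,i}x_{\gamma,i}^\top Q_\gamma x_{\gamma,i}x_{\gamma,i}^\top\mid\gamma]-Q_\gamma^3\Big).$$ Then, as functions of $\theta$, and up to multiplication by the constant $\tfrac12$ and addition of a term not depending on $\theta$, the expected losses before and after optimization are, respectively, $$\mathcal R^{drs}(\theta)\equiv\mathbb E_\gamma\big[\|\theta-\theta_\gamma\|^2_{Q_\gamma}\big]\qquad\text{and}\qquad\mathbb E_\gamma\big[\mathbb E_{\mathcal O_\gamma}[\mathcal R(\tilde\theta_\gamma(\alpha);\gamma)]\big]\equiv\mathbb E_\gamma\big[\|\theta-\theta_\gamma\|^2_{A_\gamma(\alpha)}\big].$$ The former is minimized by $\theta^*_{drs}$. As $N\to\infty$, the latter expected loss $\mathbb E_\gamma[\mathbb E_{\mathcal O_\gamma}[\mathcal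 R(\tilde\theta_\gamma(\alpha);\gamma)]]$ converges to $\mathcal R^{maml}(\theta;\alpha)$ for each $\theta$; this limit is minimized over $\theta$ by $\theta^*_{maml}(\alpha)$; and for $0<\alpha\le1/\beta$ its minimum value satisfies $\mathcal R^{maml}(\theta^*_{maml}(\alpha);\alpha)\le\mathcal R^{drs}(\theta^*_{drs})$, the right side being the minimum expected loss possible before meta-testing optimization.
   Context: Setting. Tasks $\gamma$ are drawn from a distribution $p(\gamma)$. Given task $\gamma$, data follow $y_\gamma=\theta_\gamma^\top x_\gamma+\epsilon_\gamma$, where $x_\gamma\in\mathbb R^p$ and $\epsilon_\gamma$ are independent given $\gamma$, $\epsilon_\gamma$ has mean $0$ and variance $\sigma^2_\gamma$, and $Q_\gamma=\mathbb E[x_\gamma x_\gamma^\top\mid\gamma]$. The observations $(x_{\gamma,i},y_{\gamma,i})$, $i=1,\dots,N$, are i.i.d. given $\gamma$ from this model. The moments needed for all displayed expectations are assumed finite, and the matrices inverted below are assumed invertible. Definitions. $\mathcal R(\theta;\gamma)=\tfrac12\mathbb E[(y_\gamma-\theta^\top x_\gamma)^2\mid\gamma]$ (a function of $\theta$ given $\gamma$; in $\mathcal R(\tilde\theta_\gamma(\alpha);\gamma)$ it is evaluated at $\tilde\theta_\gamma(\alpha)$, and $\mathbb E_{\mathcal O_\gamma}$ is expectation over $\mathcal O_\gamma$ given $\gamma$). $\mathcal R^{drs}(\theta)=\mathbb E_\gamma[\mathcal R(\theta;\gamma)]$ and $\mathcal R^{maml}(\theta;\alpha)=\mathbb E_\gamma[\mathcal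 R(\theta-\alpha\nabla_\theta\mathcal R(\theta;\gamma);\gamma)]$. $\theta^*_{drs}=\mathbb E_\gamma[Q_\gamma]^{-1}\mathbb E_\gamma[Q_\gamma\theta_\gamma]$ and $\theta^*_{maml}(\alpha)=\mathbb E_\gamma[S_\gamma(\alpha)]^{-1}\mathbb E_\gamma[S_\gamma(\alpha)\theta_\gamma]$. For a symmetric matrix $A$, $\|v\|_A^2=v^\top Av$; $\|Q_\gamma\|$ is the operator norm. *)

(* Defs.v *)
From HB Require Import structures.
From mathcomp Require Import all_boot all_order all_algebra.
From mathcomp Require Import all_classical all_reals all_analysis.
Set Implicit Arguments.
Unset Strict Implicit.
Unset Printing Implicit Defensive.
Import Order.TTheory GRing.Theory Num.Theory.
Import numFieldNormedType.Exports.
Local Open Scope classical_set_scope.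
Local Open Scope ring_scope.

(* Vectors of R^p are column vectors. The library norm on
   matrices is the sup norm, hence the Euclidean and operator norms below. *)

Section linear_algebra.
Context {R : realType}.

Definition enorm p (v : 'cV[R]_p) : R := Num.sqrt (\sum_(k < p) v k 0 ^+ 2).

Definition opnorm p (A : 'M[R]_p) : R :=
  sup [set enorm (A *m v) | v in [set v : 'cV[R]_p | enorm v <= 1]].

Definition dotp p (u v : 'cV[R]_p) : R := (u^T *m v) 0 0.

(* The square of the seminorm ||v||_A. *)
Definition wnorm2 p (A : 'M[R]_p) (v : 'cV[R]_p) : R := (v^T *m A *m v) 0 0.

Definition gradient p (f : 'cV[R]_p -> R) (th : 'cV[R]_p) : 'cV[R]_p :=
  \col_k 'D_(delta_mx k 0) (f : 'cV[R]_p -> R^o) th.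

(* Matrices carry no sigma-algebra in the library; R^p gets the product
   (Borel) one through its identification with tuples. *)
Definition vtuple p (v : 'cV[R]_p) : p.-tuple R := [tuple v k 0 | k < p].

End linear_algebra.

Section probability.
Context {d : measure_display} {Om : measurableType d} {R : realType}.

Definition mexp (P : probability Om R) m n (X : Om -> 'M[R]_(m, n)) :
    'M[R]_(m, n) :=
  \matrix_(i, j) fine 'E_P[fun w => X w i j].

Definition independent2 d1 d2 (T1 : measurableType d1) (T2 : measurableType d2)
    (P : probability Om R) (X : Om -> T1) (Y : Om -> T2) : Prop :=
  forall (A : set T1) (B : set T2), measurable A -> measurable B ->
    P (X @^-1` A `&` Y @^-1` B) = (P (X @^-1` A) * P (Y @^-1` B))%E.

Definition mutually_independent d' (T' : measurableType d')
    (P : probability Om R) (X : nat -> Om -> T') : Prop :=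
  forall (s : seq nat) (A : nat -> set T'), uniq s ->
    (forall i, measurable (A i)) ->
    P (\bigcap_(i in [set` s]) X i @^-1` A i) =
    (\prod_(i <- s) P (X i @^-1` A i))%E.

Definition same_law d' (T' : measurableType d')
    (P : probability Om R) (X Y : Om -> T') : Prop :=
  forall A : set T', measurable A -> P (X @^-1` A) = P (Y @^-1` A).

End probability.

(* Conditional expectation given the task g is expectation under data_law g.
   The pair (feature, response g) is a generic draw from task g; the
   observations are (obs_feature i, obs_response i) for i = 0, 1, 2, ..., and
   the sample of size N consists of the first N of them. *)
Record meta_regression (R : realType) (d d' : measure_display)
    (T : measurableType d) (Om : measurableType d') (p : nat) :=
  MetaRegression {
    task_law : probability T R;
    data_law : T -> probability Om R;
    task_param : T -> 'cV[R]_p;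
    noise_sd : T -> R;
    feature : Om -> 'cV[R]_p;
    noise : Om -> R;
    obs_feature : nat -> Om -> 'cV[R]_p;
    obs_response : nat -> Om -> R;
    response := (fun (g : T) (w : Om) =>
      dotp (task_param g) (feature w) + noise w);
    measurable_data_law :
      measurable_fun setT (data_law : T -> pprobability Om R);
    measurable_task_param : measurable_fun setT (fun g => vtuple (task_param g));
    measurable_feature : measurable_fun setT (fun w => vtuple (feature w));
    measurable_noise : measurable_fun setT noise;
    measurable_obs_feature : forall i,
      measurable_fun setT (fun w => vtuple (obs_feature i w));
    measurable_obs_response : forall i, measurable_fun setT (obs_response i);
    feature_noise_indep : forall g,
      independent2 (data_law g) (fun w => vtuple (feature w)) noise;
    noise_mean : forall g, ('E_(data_law g)[noise] = 0)%E;
    noise_variance : forall g,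
      ('V_(data_law g)[noise] = (noise_sd g ^+ 2)%:E)%E;
    obs_indep : forall g,
      mutually_independent (data_law g)
        (fun i w => (vtuple (obs_feature i w), obs_response i w));
    obs_law : forall g i,
      same_law (data_law g)
        (fun w => (vtuple (obs_feature i w), obs_response i w))
        (fun w => (vtuple (feature w), response g w)) }.

Section losses.
Context {R : realType} {d d' : measure_display} {T : measurableType d}
  {Om : measurableType d'} {p : nat}.
Variable M : meta_regression R T Om p.
Implicit Types (g : T) (th : 'cV[R]_p) (alpha : R) (N : nat).

Definition Qmx g : 'M[R]_p :=
  mexp (data_law M g) (fun w => feature M w *m (feature M w)^T).

Definition Smx alpha g : 'M[R]_p :=
  (1%:M - alpha *: Qmx g) *m Qmx g *m (1%:M - alpha *: Qmx g).

Definition Amx alpha N g : 'M[R]_p :=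
  Smx alpha g + (alpha ^+ 2 / N%:R) *:
    (mexp (data_law M g)
       (fun w => feature M w *m (feature M w)^T *m Qmx g
                 *m feature M w *m (feature M w)^T)
     - Qmx g *m Qmx g *m Qmx g).

Definition risk g th : R :=
  2^-1 * fine 'E_(data_law M g)
    [fun w => (response M g w - dotp th (feature M w)) ^+ 2].

Definition sgd alpha N th (w : Om) : 'cV[R]_p :=
  th - (alpha / N%:R) *:
    \sum_(i < N) (obs_feature M i w *m (obs_feature M i w)^T *m th
                  - obs_response M i w *: obs_feature M i w).

(* The losses below are integrals of nonnegative functions, taken in the
   extended reals. *)
Definition drs_loss th : \bar R := ('E_(task_law M)[fun g => risk g th])%E.

Definition maml_loss alpha th : \bar R :=
  ('E_(task_law M)[fun g => risk g (th - alpha *: gradient (risk g) th)])%E.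

Definition sgd_loss alpha N th : \bar R :=
  (\int[task_law M]_g 'E_(data_law M g)[fun w => risk g (sgd alpha N th w)])%E.

Definition mean_wnorm2 (W : T -> 'M[R]_p) th : \bar R :=
  ('E_(task_law M)[fun g => wnorm2 (W g) (th - task_param M g)])%E.

Definition theta_drs : 'cV[R]_p :=
  invmx (mexp (task_law M) Qmx) *m
  mexp (task_law M) (fun g => Qmx g *m task_param M g).

Definition theta_maml alpha : 'cV[R]_p :=
  invmx (mexp (task_law M) (Smx alpha)) *m
  mexp (task_law M) (fun g => Smx alpha g *m task_param M g).

End losses.

Definition equiv_loss (R : realType) p (f h : 'cV[R]_p -> \bar R) : Prop :=
  exists c : R, forall th, f th = ((2^-1)%:E * h th + c%:E)%E.

Definition minimizes (R : realType) p (f : 'cV[R]_p -> \bar R)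
    (th0 : 'cV[R]_p) : Prop :=
  forall th, (f th0 <= f th)%E.

(* Main.v *)
(* For a fixed task put v = th - th_g. The noise is centred and independent of
   the features, so the risk at th is half of ||v||_Q^2 + sigma^2. One SGD step
   sends v to v - (alpha / N) sum_i u_i with u_i = x_i x_i^T v - eps_i x_i
   i.i.d. of mean Q v; expanding the square and separating the N diagonal from
   the N(N - 1) off-diagonal terms gives
     E ||v - (alpha / N) sum_i u_i||_Q^2
       = ||v||_{A(alpha)}^2 + (alpha^2 / N) sigma^2 tr(Q^2),
   where the last term is integrable over the tasks because ||Q|| <= beta a.s.
   Everything is affine in 1 / N, which yields the limit. The two minimizers
   solve the normal equations of a weighted least squares problem, and the last
   inequality follows from S(alpha) <= Q, that is from
   alpha^2 Q^3 <= alpha Q^2 <= 2 alpha Q^2 when alpha ||Q|| <= 1. *)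
From HB Require Import structures.
Require Import Defs.
From mathcomp Require Import all_boot all_order all_algebra.
From mathcomp Require Import all_classical all_reals all_analysis.
From mathcomp Require Import measurable_realfun ring lra.
Import Order.TTheory GRing.Theory Num.Theory.
Import numFieldNormedType.Exports.
Local Open Scope classical_set_scope.
Local Open Scope ring_scope.

Set Implicit Arguments.
Unset Strict Implicit.
Unset Printing Implicit Defensive.

(** * Means of real- and matrix-valued functions *)

Section has_mean.
Context {d : measure_display} {T : measurableType d} {R : realType}.
Variable P : probability T R.
Implicit Types (f g : T -> R) (a b c : R).

(** Integrability is bundled with the value, so that means combine linearly without side conditions
    and [fine] of an expectation is never a default value. *)
Definition has_mean f a : Prop :=
  P.-integrable setT (EFin \o f) /\ (\int[P]_x (f x)%:E = a%:E)%E.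

Lemma has_mean_expectation f a : has_mean f a -> 'E_P[f]%E = a%:E.
Proof. by rewrite unlock => -[]. Qed.

Lemma fine_expectation f a : has_mean f a -> fine 'E_P[f]%E = a.
Proof. by move=> /has_mean_expectation ->. Qed.

Lemma integrable_has_mean f :
  P.-integrable setT (EFin \o f) -> has_mean f (fine 'E_P[f]%E).
Proof. by move=> fi; split => //; rewrite unlock fineK // integrable_fin_num. Qed.

Lemma has_mean_measurable f a : has_mean f a -> measurable_fun setT f.
Proof. by move=> [/integrableP[/measurable_EFinP]]. Qed.

Lemma has_meanW f g a b : has_mean f a -> f =1 g -> a = b -> has_mean g b.
Proof. by move=> fa /funext <- <-. Qed.

Lemma has_mean_cst c : has_mean (fun=> c) c.
Proof.
split; first exact: finite_measure_integrable_cst.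
by have := expectation_cst P c; rewrite unlock.
Qed.

Lemma has_meanD f g a b :
  has_mean f a -> has_mean g b -> has_mean (fun x => f x + g x) (a + b).
Proof.
move=> [fi fa] [gi gb]; split; first exact: (integrableD _ fi gi).
by rewrite integralD_EFin // fa gb.
Qed.

Lemma has_meanZ c f a : has_mean f a -> has_mean (fun x => c * f x) (c * a).
Proof.
move=> [fi fa]; split; first exact: (integrableZl _ c fi).
under eq_integral do rewrite EFinM.
by rewrite integralZl // fa.
Qed.

Lemma has_meanB f g a b :
  has_mean f a -> has_mean g b -> has_mean (fun x => f x - g x) (a - b).
Proof.
move=> fa gb; apply: (has_meanW (has_meanD fa (has_meanZ (-1) gb))).
  by move=> x; rewrite mulN1r.
by rewrite mulN1r.
Qed.

Lemma has_mean_sum (I : Type) (s : seq I) (F : I -> T -> R) (G : I -> R) :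
  (forall i, has_mean (F i) (G i)) ->
  has_mean (fun x => \sum_(i <- s) F i x) (\sum_(i <- s) G i).
Proof.
move=> FG; elim: s => [|i s IHs].
  apply: (has_meanW (has_mean_cst 0)); last by rewrite big_nil.
  by move=> x; rewrite big_nil.
apply: (has_meanW (has_meanD (FG i) IHs)); last by rewrite big_cons.
by move=> x; rewrite big_cons.
Qed.

Lemma has_mean_ge0 f a : has_mean f a -> (forall x, 0 <= f x) -> 0 <= a.
Proof.
move=> [_ fa] f0; rewrite -lee_fin -fa integral_ge0 // => x _.
by rewrite lee_fin.
Qed.

Lemma ae_has_mean_le f g a b : has_mean f a -> has_mean g b ->
  (forall x, 0 <= f x) -> (forall x, 0 <= g x) ->
  {ae P, forall x, f x <= g x} -> a <= b.
Proof.
move=> fa gb f0 g0 fg; have mf := has_mean_measurable fa.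
have mg := has_mean_measurable gb.
case: fa gb => _ fa [_ gb]; rewrite -lee_fin -fa -gb.
apply: ae_ge0_le_integral => //=.
- by move=> x _; rewrite lee_fin.
- exact/measurable_EFinP.
- by move=> x _; rewrite lee_fin.
- exact/measurable_EFinP.
- by apply: filterS fg => x fgx _; rewrite lee_fin.
Qed.

Lemma le_has_mean f g a : has_mean f a -> measurable_fun setT g ->
  (forall x, `|g x| <= f x) -> exists b, has_mean g b.
Proof.
move=> [fi _] mg gf; exists (fine 'E_P[g]%E); apply: integrable_has_mean.
apply: le_integrable fi => //; first exact/measurable_EFinP.
by move=> x _; rewrite !abse_EFin lee_fin (le_trans (gf x)) // ler_norm.
Qed.

(** Truncating [g] at the bound makes the product dominated by a multiple of [f] everywhere, and
    changes it only on a null set. *)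
Lemma has_mean_mul_ae_bounded f g a c : has_mean f a -> measurable_fun setT g ->
  (forall x, 0 <= f x) -> (forall x, 0 <= g x) ->
  {ae P, forall x, g x <= c} -> exists b, has_mean (fun x => f x * g x) b.
Proof.
move=> fa mg f0 g0 gc; have mf := has_mean_measurable fa.
(* The cap is [|c|] rather than [c] so that the truncated factor stays nonnegative whatever the sign
   of [c]. *)
pose h x := f x * Num.min (g x) `|c|.
have mh : measurable_fun setT h.
  by apply: measurable_funM => //; exact: measurable_minr.
have [b hb] : exists b, has_mean h b.
  apply: (le_has_mean (has_meanZ `|c| fa)) => // x.
  have m0 : 0 <= Num.min (g x) `|c| by rewrite le_min g0 normr_ge0.
  by rewrite ger0_norm ?mulr_ge0 // [leRHS]mulrC ler_wpM2l // ge_min lexx orbT.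
exists b; have mfg : measurable_fun setT (fun x => f x * g x).
  exact: measurable_funM.
have fgh : ae_eq P setT (EFin \o (fun x => f x * g x)) (EFin \o h).
  apply: filterS gc => x gxc _ /=; congr (_%:E); rewrite /h; congr (_ * _).
  by rewrite min_l // (le_trans gxc) // ler_norm.
split; last first.
  case: hb => _ <-; apply: ae_eq_integral fgh => //; exact/measurable_EFinP.
case: hb => /integrableP[_ hi] _; apply/integrableP.
split; first exact/measurable_EFinP.
rewrite (ae_eq_integral (fun x => `|(h x)%:E|%E)) //.
- by apply: measurableT_comp => //; exact/measurable_EFinP.
- by apply: measurableT_comp => //; exact/measurable_EFinP.
- by apply: filterS fgh => x fghx _; congr abse; exact: fghx.
Qed.
End has_mean.

(** * Entrywise means of random matrices *)

Section matrix_mean.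
Context {d : measure_display} {T : measurableType d} {R : realType}.
Variable P : probability T R.

Definition mx_mean m n (X : T -> 'M[R]_(m, n)) (A : 'M[R]_(m, n)) : Prop :=
  forall i j, has_mean P (fun w => X w i j) (A i j).

Lemma mx_meanW m n (X Y : T -> 'M[R]_(m, n)) A B :
  mx_mean X A -> X =1 Y -> A = B -> mx_mean Y B.
Proof. by move=> XA /funext <- <-. Qed.

Lemma mx_meanB m n (X Y : T -> 'M[R]_(m, n)) A B :
  mx_mean X A -> mx_mean Y B -> mx_mean (fun w => X w - Y w) (A - B).
Proof.
move=> XA YB i j; apply: (has_meanW (has_meanB (XA i j) (YB i j))).
  by move=> w; rewrite !mxE.
by rewrite !mxE.
Qed.

Lemma mx_mean_mull m n k (C : 'M[R]_(k, m)) (X : T -> 'M[R]_(m, n)) A :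
  mx_mean X A -> mx_mean (fun w => C *m X w) (C *m A).
Proof.
move=> XA i j.
apply: (has_meanW (has_mean_sum (index_enum 'I_m)
  (fun k => has_meanZ (C i k) (XA k j)))); last by rewrite mxE.
by move=> w; rewrite mxE.
Qed.

Lemma mx_mean_mulr m n k (C : 'M[R]_(n, k)) (X : T -> 'M[R]_(m, n)) A :
  mx_mean X A -> mx_mean (fun w => X w *m C) (A *m C).
Proof.
move=> XA i j.
apply: (has_meanW (has_mean_sum (index_enum 'I_n)
  (fun k => has_meanZ (C k j) (XA i k)))) => [w|].
  by rewrite mxE; apply: eq_bigr => l _; rewrite mulrC.
by rewrite mxE; apply: eq_bigr => l _; rewrite mulrC.
Qed.

Lemma mx_mean_sum (I : Type) (s : seq I) m n (X : I -> T -> 'M[R]_(m, n)) A :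
  (forall i, mx_mean (X i) (A i)) ->
  mx_mean (fun w => \sum_(i <- s) X i w) (\sum_(i <- s) A i).
Proof.
move=> XA i j.
apply: (has_meanW (has_mean_sum s (fun k => XA k i j))) => [w|];
  by rewrite summxE.
Qed.

Lemma has_mean_trace n (X : T -> 'M[R]_n) A :
  mx_mean X A -> has_mean P (fun w => \tr (X w)) (\tr A).
Proof. by move=> XA; apply: has_mean_sum => i; exact: XA. Qed.

Lemma mx_mean_mexp m n (X : T -> 'M[R]_(m, n)) :
  (forall i j, P.-integrable setT (fun w => (X w i j)%:E)) ->
  mx_mean X (mexp P X).
Proof. by move=> Xi i j; rewrite mxE; apply: integrable_has_mean; exact: Xi. Qed.

End matrix_mean.

(** * Change of variables, equality in law and independence *)

Section transfer.
Context {R : realType} {d : measure_display} {T : measurableType d}.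
Variable P : probability T R.

Lemma has_mean_distribution d1 (T1 : measurableType d1) (X : {mfun T >-> T1})
    (f : T1 -> R) a :
  measurable_fun setT f ->
  has_mean (distribution P X) f a <-> has_mean P (f \o X) a.
Proof.
move=> mf; have mEf : measurable_fun setT (EFin \o f) by exact/measurable_EFinP.
have mEfX : measurable_fun setT (EFin \o (f \o X)).
  exact: (measurableT_comp mEf).
suff fi : (distribution P X).-integrable setT (EFin \o f) <->
    P.-integrable setT (EFin \o (f \o X)).
  split => -[fX fa]; (split; first exact/fi); rewrite -fa.
    by rewrite integral_distribution //; exact/fi.
  by rewrite integral_distribution //; exact/fi.
have norm_fi :
    (\int[distribution P X]_x `|(f x)%:E| = \int[P]_x `|(f (X x))%:E|)%E.
  by rewrite ge0_integral_distribution //; exact: measurableT_comp.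
by split=> /integrableP[_ fi]; apply/integrableP; split => //=;
  move: fi; rewrite norm_fi.
Qed.

Lemma has_mean_same_law d1 (T1 : measurableType d1) (X Y : {mfun T >-> T1})
    (f : T1 -> R) a :
  measurable_fun setT f ->
  same_law P X Y -> has_mean P (f \o Y) a -> has_mean P (f \o X) a.
Proof.
move=> mf XY /has_mean_distribution -/(_ mf) [fi fa].
apply/has_mean_distribution => //.
have eqm (h : T1 -> \bar R) :
    (\int[distribution P X]_x h x = \int[distribution P Y]_x h x)%E.
  by apply: eq_measure_integral => A mA _; exact: XY.
split; last by rewrite eqm.
by move/integrableP : fi => [mfi]; rewrite -eqm => fi; apply/integrableP.
Qed.

Section product.
Context d1 d2 (T1 : measurableType d1) (T2 : measurableType d2).
Variables (X : {mfun T >-> T1}) (Y : {mfun T >-> T2}).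
Hypothesis XY : independent2 P X Y.

Let mXY : measurable_fun setT (fun w => (X w, Y w)).
Proof. exact: measurable_fun_pair. Qed.

Let Z : {mfun T >-> (T1 * T2)%type} := HB.pack (fun w => (X w, Y w))
  (isMeasurableFun.Build _ _ _ _ (fun w => (X w, Y w)) mXY).

(** Independence says that the joint law agrees with the product law on rectangles, and a product
    measure is determined by its values there. *)
Let integral_joint (h : T1 * T2 -> \bar R) :
  (\int[distribution P X \x distribution P Y]_z h z =
   \int[distribution P Z]_z h z)%E.
Proof.
apply: eq_measure_integral => A mA _.
by apply: product_measure_unique => // B C mB mC; rewrite -[RHS]XY.
Qed.

Lemma has_mean_indepM (f : T1 -> R) (g : T2 -> R) a b :
  measurable_fun setT f -> measurable_fun setT g ->
  has_mean P (f \o X) a -> has_mean P (g \o Y) b ->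
  has_mean P (fun w => f (X w) * g (Y w)) (a * b).
Proof.
move=> mf mg /has_mean_distribution -/(_ mf) [fi fa].
move=> /has_mean_distribution -/(_ mg) [gi gb].
pose h (z : T1 * T2) := f z.1 * g z.2.
have mh : measurable_fun setT h.
  by apply: measurable_funM; apply: measurableT_comp.
apply/(has_mean_distribution Z _ mh).
have mEh : measurable_fun setT (EFin \o h) by exact/measurable_EFinP.
(* Tonelli: the integral of the absolute value factors into two finite integrals, which then
   licenses Fubini for the value. *)
have hi : (distribution P X \x distribution P Y)%E.-integrable setT (EFin \o h).
  apply/(integrable12ltyP _ _ mEh).
  have -> : (fun x => \int[distribution P Y]_y `|(EFin \o h) (x, y)|)%E =
      (fun x => `|(f x)%:E| * \int[distribution P Y]_y `|(g y)%:E|)%E.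
    apply/funext => x; rewrite -ge0_integralZl //.
    - by apply: eq_integral => y _ /=; rewrite normrM EFinM.
    - by apply: measurableT_comp => //; exact/measurable_EFinP.
  move/integrableP : fi => [_ fi]; move/integrableP : gi => [mgi gi].
  rewrite ge0_integralZr //; last 2 first.
    by apply: measurableT_comp => //; exact/measurable_EFinP.
    exact: integral_ge0.
  apply: lte_mul_pinfty => //; first exact: integral_ge0.
  by rewrite ge0_fin_numE // integral_ge0.
split.
  apply/integrableP; split => //.
  by rewrite -integral_joint; case/integrableP : hi.
rewrite -integral_joint -integral12_prod_meas1 // /fubini_F.
rewrite EFinM -fa -integralZr //.
by apply: eq_integral => x _; rewrite -gb -integralZl.
Qed.
End product.
End transfer.

(** * Quadratic forms and the operator norm *)

Section quadratic_forms.
Context {R : realType} {p : nat}.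
Implicit Types (A B : 'M[R]_p) (u v w : 'cV[R]_p) (a b c : R).

Definition bform A u v : R := (u^T *m A *m v) 0 0.

Lemma wnorm2E A v : wnorm2 A v = bform A v v. Proof. by []. Qed.

Lemma bformDl A u v w : bform A (u + v) w = bform A u w + bform A v w.
Proof. by rewrite /bform linearD /= !mulmxDl mxE. Qed.

Lemma bformDr A u v w : bform A u (v + w) = bform A u v + bform A u w.
Proof. by rewrite /bform mulmxDr mxE. Qed.

Lemma bformZl A c u v : bform A (c *: u) v = c * bform A u v.
Proof. by rewrite /bform linearZ /= -!scalemxAl mxE. Qed.

Lemma bformZr A c u v : bform A u (c *: v) = c * bform A u v.
Proof. by rewrite /bform -!scalemxAr mxE. Qed.

Lemma bformNl A u v : bform A (- u) v = - bform A u v.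
Proof. by rewrite -scaleN1r bformZl mulN1r. Qed.

Lemma bformNr A u v : bform A u (- v) = - bform A u v.
Proof. by rewrite -scaleN1r bformZr mulN1r. Qed.

Lemma bformC A u v : A^T = A -> bform A u v = bform A v u.
Proof.
move=> sA; rewrite /bform -[in LHS](trmxK (u^T *m A *m v)) mxE.
by rewrite !trmx_mul trmxK sA mulmxA.
Qed.

Lemma bform_sumr (I : Type) (s : seq I) A u (F : I -> 'cV[R]_p) :
  bform A u (\sum_(i <- s) F i) = \sum_(i <- s) bform A u (F i).
Proof. by rewrite /bform mulmx_sumr summxE. Qed.

Lemma bform_suml (I : Type) (s : seq I) A u (F : I -> 'cV[R]_p) :
  bform A (\sum_(i <- s) F i) u = \sum_(i <- s) bform A (F i) u.
Proof. by rewrite /bform linear_sum /= !mulmx_suml summxE. Qed.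

(** Makes a bilinear form linear in the outer product of its arguments, so that its mean can be read
    off from the mean of a random matrix. *)
Lemma bform_trace A u v : bform A u v = \tr (A *m (v *m u^T)).
Proof.
by rewrite mulmxA mxtrace_mulC mulmxA [RHS]/mxtrace big_ord1.
Qed.

Lemma bform_delta A i j : bform A (delta_mx i 0) (delta_mx j 0) = A i j.
Proof. by rewrite /bform trmx_delta -rowE -colE !mxE. Qed.

Lemma bform_delta_l A i v : bform A (delta_mx i 0) v = (A *m v) i 0.
Proof. by rewrite /bform trmx_delta -mulmxA -rowE !mxE. Qed.

Lemma bform_sum A u v :
  bform A u v = \sum_i \sum_j A i j * (u i 0 * v j 0).
Proof.
rewrite /bform -mulmxA mxE; apply: eq_bigr => i _.
by rewrite !mxE mulr_sumr; apply: eq_bigr => j _; rewrite mulrCA.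
Qed.

Lemma bform_polar A u v : A^T = A ->
  bform A u v = 2^-1 * (wnorm2 A (u + v) - wnorm2 A u - wnorm2 A v).
Proof.
move=> sA; rewrite !wnorm2E !(bformDl, bformDr) (bformC v u sA).
by field.
Qed.

Lemma wnorm2_sub A u v : A^T = A ->
  wnorm2 A (u - v) = wnorm2 A u - 2 * bform A u v + wnorm2 A v.
Proof.
move=> sA; rewrite !wnorm2E !(bformDl, bformDr, bformNl, bformNr).
by rewrite (bformC v u sA); ring.
Qed.

Lemma wnorm2D A B v : wnorm2 (A + B) v = wnorm2 A v + wnorm2 B v.
Proof. by rewrite /wnorm2 mulmxDr mulmxDl mxE. Qed.

Lemma wnorm2Z A c v : wnorm2 (c *: A) v = c * wnorm2 A v.
Proof. by rewrite /wnorm2 -scalemxAr -scalemxAl mxE. Qed.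

Lemma wnorm2B A B v : wnorm2 (A - B) v = wnorm2 A v - wnorm2 B v.
Proof. by rewrite wnorm2D -scaleN1r wnorm2Z mulN1r. Qed.

Lemma wnorm2_congr A B v : wnorm2 (B^T *m A *m B) v = wnorm2 A (B *m v).
Proof. by rewrite /wnorm2 trmx_mul !mulmxA. Qed.

Lemma wnorm2_rank1 u v : wnorm2 (u *m u^T) v = dotp v u ^+ 2.
Proof.
rewrite /wnorm2 /dotp mulmxA -mulmxA mxE big_ord1 expr2; congr (_ * _).
by rewrite -[in LHS](trmxK v) -trmx_mul mxE.
Qed.

Lemma dotpE u v : dotp u v = \sum_(k < p) u k 0 * v k 0.
Proof. by rewrite /dotp mxE; apply: eq_bigr => k _; rewrite mxE. Qed.

(** The inner factor [u^T *m A *m u] is a 1 by 1 matrix and comes out as a scalar. *)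
Lemma outer_sandwich A u :
  u *m u^T *m A *m u *m u^T = bform A u u *: (u *m u^T).
Proof.
rewrite -(mulmxA u u^T) -(mulmxA u (u^T *m A)) [X in u *m X]mx11_scalar.
by rewrite mul_mx_scalar scalemxAl.
Qed.

Lemma dotpC u v : dotp u v = dotp v u.
Proof. by rewrite !dotpE; apply: eq_bigr => k _; rewrite mulrC. Qed.

Lemma outer_mulmx u v : u *m u^T *m v = dotp v u *: u.
Proof.
by rewrite -mulmxA [X in u *m X]mx11_scalar mul_mx_scalar dotpC.
Qed.

Lemma dotpvv u : dotp u u = enorm u ^+ 2.
Proof.
rewrite /enorm sqr_sqrtr; first by rewrite dotpE; apply: eq_bigr.
by apply: sumr_ge0 => k _; rewrite sqr_ge0.
Qed.

Lemma dotp_bform u v : dotp u v = bform 1%:M u v.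
Proof. by rewrite /bform mulmx1. Qed.

Lemma enormZ c u : enorm (c *: u) = `|c| * enorm u.
Proof.
rewrite /enorm -sqrtr_sqr -sqrtrM ?sqr_ge0 // mulr_sumr.
by congr Num.sqrt; apply: eq_bigr => k _; rewrite mxE exprMn.
Qed.

Lemma enorm_ge0 u : 0 <= enorm u. Proof. exact: sqrtr_ge0. Qed.

Lemma enorm_coord u k : `|u k 0| <= enorm u.
Proof.
rewrite /enorm -sqrtr_sqr ler_wsqrtr // (bigD1 k) //= lerDl.
by apply: sumr_ge0 => i _; rewrite sqr_ge0.
Qed.

Lemma enorm0_eq0 u : enorm u = 0 -> u = 0.
Proof.
move=> u0; apply/matrixP => k j; rewrite ord1 mxE.
by apply/eqP; rewrite -normr_le0 -u0 enorm_coord.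
Qed.

(** Without an upper bound the supremum in [opnorm] would be meaningless. Coordinates of a unit
    vector are at most 1 in absolute value, so each row contributes at most the sum of its absolute
    entries. *)
Lemma has_ubound_opnorm A :
  has_ubound [set enorm (A *m v) | v in [set v : 'cV[R]_p | enorm v <= 1]].
Proof.
exists (Num.sqrt (\sum_i (\sum_j `|A i j|) ^+ 2)) => _ [v /= v1 <-].
rewrite /enorm ler_wsqrtr // ler_sum // => i _.
rewrite -[leLHS]real_normK ?num_real // ler_sqr ?nnegrE ?sumr_ge0 //.
rewrite mxE (le_trans (ler_norm_sum _ _ _)) // ler_sum // => j _.
by rewrite normrM ler_piMr // (le_trans (enorm_coord v j)).
Qed.

Lemma enorm_mulmx A v : enorm (A *m v) <= opnorm A * enorm v.
Proof.
have [v0|v0] := eqVneq (enorm v) 0.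
  rewrite v0 (enorm0_eq0 v0) mulmx0 -(scale0r (0 : 'cV_p)) enormZ.
  by rewrite normr0 mul0r mulr0.
have v_gt0 : 0 < enorm v by rewrite lt_neqAle eq_sym v0 enorm_ge0.
rewrite -ler_pdivrMr //; apply: ub_le_sup; first exact: has_ubound_opnorm.
exists ((enorm v)^-1 *: v) => /=.
  by rewrite enormZ ger0_norm ?invr_ge0 ?enorm_ge0 // mulVf.
by rewrite -scalemxAr enormZ ger0_norm ?invr_ge0 ?enorm_ge0 // mulrC.
Qed.

Lemma dotp_mulmx_le A b v : opnorm A <= b ->
  dotp (A *m v) (A *m v) <= b ^+ 2 * dotp v v.
Proof.
move=> Ab; rewrite !dotpvv -exprMn.
have Avb : enorm (A *m v) <= b * enorm v.
  by rewrite (le_trans (enorm_mulmx A v)) // ler_wpM2r // enorm_ge0.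
by rewrite ler_sqr ?nnegrE ?enorm_ge0 // (le_trans (enorm_ge0 _) Avb).
Qed.

Lemma dotp_ge0 u : 0 <= dotp u u. Proof. by rewrite dotpvv sqr_ge0. Qed.

(* Expand [0 <= |b v - A v|^2] and bound [|A v|^2] by [b^2 |v|^2]. *)
Lemma wnorm2_le_opnorm A b v : A^T = A -> 0 < b -> opnorm A <= b ->
  wnorm2 A v <= b * dotp v v.
Proof.
move=> sA b0 Ab; have := dotp_mulmx_le v Ab.
have := dotp_ge0 (b *: v - A *m v).
have -> : wnorm2 A v = dotp v (A *m v) by rewrite /wnorm2 /dotp mulmxA.
rewrite [dotp (_ - _) _]dotp_bform -wnorm2E wnorm2_sub ?trmx1 //.
rewrite !wnorm2E !bformZl !bformZr -!dotp_bform => h1 h2.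
suff: b * dotp v (A *m v) <= b * (b * dotp v v) by rewrite ler_pM2l.
by lra.
Qed.

(** By symmetry the j-th diagonal entry of [A *m A] is the squared length of [A e_j], hence at most
    [b ^+ 2]. *)
Lemma trace_sqr_le A b : A^T = A -> opnorm A <= b ->
  \tr (A *m A) <= b ^+ 2 *+ p.
Proof.
move=> sA Ab; rewrite -[X in _ *+ X]card_ord -sumr_const ler_sum // => j _.
have := dotp_mulmx_le (delta_mx j 0) Ab.
rewrite [dotp (delta_mx _ _) _]dotp_bform bform_delta mxE eqxx mulr1.
rewrite dotp_bform /bform mulmx1 trmx_mul sA trmx_delta !mulmxA.
by rewrite -[_ *m A]mulmxA -rowE -colE !mxE.
Qed.

Lemma trace_sqr_ge0 A : A^T = A -> 0 <= \tr (A *m A).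
Proof.
move=> sA; apply: sumr_ge0 => i _; rewrite mxE sumr_ge0 // => j _.
by rewrite -[in X in _ * X]sA mxE -expr2 sqr_ge0.
Qed.

(** With [z = |A v|^2] and [w = ||A v||_A^2], the right side exceeds the left by [2 a z - a^2 w],
    which is nonnegative because [a w <= a b z <= z]. *)
Lemma wnorm2_step_le A a b v : A^T = A -> 0 <= a -> 0 < b -> a * b <= 1 ->
  opnorm A <= b ->
  wnorm2 ((1%:M - a *: A) *m A *m (1%:M - a *: A)) v <= wnorm2 A v.
Proof.
move=> sA a0 b0 ab Ab; have := wnorm2_le_opnorm (A *m v) sA b0 Ab.
have sB : (1%:M - a *: A)^T = 1%:M - a *: A.
  by rewrite linearB linearZ /= trmx1 sA.
rewrite -{1}sB wnorm2_congr mulmxBl mul1mx -scalemxAl wnorm2_sub //.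
have -> : bform A v (a *: (A *m v)) = a * dotp (A *m v) (A *m v).
  by rewrite bformZr /bform /dotp trmx_mul sA.
rewrite [wnorm2 A (a *: _)]wnorm2E bformZl bformZr -wnorm2E.
move: (dotp_ge0 (A *m v)); set z := dotp _ _; set w := wnorm2 A _ => z0 wz.
have : a * w <= z.
  rewrite (le_trans (ler_wpM2l a0 wz)) // mulrA -[leRHS]mul1r.
  exact: ler_wpM2r.
by move=> /(ler_wpM2l a0); have := mulr_ge0 a0 z0; lra.
Qed.

End quadratic_forms.

(** * Weighted least squares *)

Section weighted_least_squares.
Context {R : realType} {d : measure_display} {T : measurableType d} {p : nat}.
Variables (P : probability T R) (W : T -> 'M[R]_p) (th_ : T -> 'cV[R]_p).
Hypothesis sW : forall g, (W g)^T = W g.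
Hypothesis iW : forall th : 'cV[R]_p,
  P.-integrable setT (fun g => (wnorm2 (W g) (th - th_ g))%:E).
Implicit Types th u v : 'cV[R]_p.

Let err th g := wnorm2 (W g) (th - th_ g).

Let err_mean th : has_mean P (err th) (fine 'E_P[err th]%E).
Proof. exact: integrable_has_mean (iW th). Qed.

(* Only the errors are assumed integrable: the entries of [W] and of [W th_]
   are recovered by polarization. *)
Let wnorm2_mean th : exists b, has_mean P (fun g => wnorm2 (W g) th) b.
Proof.
eexists; apply: (has_meanW (has_meanB (has_meanZ 2^-1
  (has_meanD (err_mean th) (err_mean (- th)))) (err_mean 0))); last by [].
move=> g; rewrite /err !wnorm2_sub // !wnorm2E !(bformNl, bformNr).
by rewrite -(scale0r 0) !(bformZl, bformZr); field.
Qed.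

Lemma mx_mean_weight : mx_mean P W (mexp P W).
Proof.
apply: mx_mean_mexp => i j.
have [b1 h1] := wnorm2_mean (delta_mx i 0).
have [b2 h2] := wnorm2_mean (delta_mx j 0).
have [b3 h3] := wnorm2_mean (delta_mx i 0 + delta_mx j 0).
have [h _] := has_meanZ 2^-1 (has_meanB (has_meanB h3 h1) h2).
by apply: eq_integrable h => // g _ /=; rewrite -bform_polar // bform_delta.
Qed.

Lemma mx_mean_weight_param :
  mx_mean P (fun g => W g *m th_ g) (mexp P (fun g => W g *m th_ g)).
Proof.
apply: mx_mean_mexp => i j; rewrite ord1.
have [b1 h1] := wnorm2_mean (delta_mx i 0).
(* The cross term of [e_i] with [th_ g] is half of [||e_i||_W^2] plus the error at 0 minus the error
   at [e_i]. *)
have [h _] := has_meanZ 2^-1 (has_meanD h1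
  (has_meanB (err_mean 0) (err_mean (delta_mx i 0)))).
apply: eq_integrable h => // g _ /=; rewrite -bform_delta_l; congr (_%:E).
rewrite /err !wnorm2_sub // !wnorm2E -(scale0r 0) !(bformZl, bformZr).
by field.
Qed.

Hypothesis W0 : forall g v, 0 <= wnorm2 (W g) v.

(** Expanding the error at [th] around [th0] leaves the error at [th0], a nonnegative quadratic term
    in [u = th - th0], and a cross term of mean zero. *)
Lemma weighted_least_squares_min th a b : mexp P W \in unitmx ->
  has_mean P (err (invmx (mexp P W) *m mexp P (fun g => W g *m th_ g))) a ->
  has_mean P (err th) b -> a <= b.
Proof.
set m := mexp P W; set c := mexp P _; set th0 := _ *m c => um ha hb.
set u := th - th0.
have hu : has_mean P (fun g => wnorm2 (W g) u) (wnorm2 m u).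
  exact: (mx_mean_mulr u (mx_mean_mull u^T mx_mean_weight)).
(* The normal equation [m *m th0 = c] makes the mean of the cross term vanish. *)
have hc : has_mean P (fun g => bform (W g) u (th0 - th_ g)) 0.
  apply: (has_meanW ((mx_mean_mull u^T (mx_meanB
    (mx_mean_mulr th0 mx_mean_weight) mx_mean_weight_param)) 0 0)).
    by move=> g; rewrite -mulmxBr mulmxA.
  by rewrite -/m mulKVmx // subrr mulmx0 mxE.
have := has_mean_ge0 hu (W0^~ u).
suff -> : b = a + (wnorm2 m u + 2 * 0) by lra.
have := has_meanD ha (has_meanD hu (has_meanZ 2 hc)).
move/fine_expectation <-; rewrite -(fine_expectation hb).
congr (fine 'E_P[_]%E); apply/funext => g.
rewrite /err !wnorm2E [th - _](_ : _ = u + (th0 - th_ g)); last first.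
  by rewrite addrA subrK.
rewrite [bform _ (u + _) (u + _)]bformDl !(bformDr _ _ u).
by rewrite (bformC (th0 - _) u) //; ring.
Qed.
End weighted_least_squares.

(** * A single task *)

Section fourth_moments.
Context {R : realType} {d : measure_display} {T : measurableType d}.
Variable P : probability T R.

Definition has_moment4 (f : T -> R) : Prop :=
  measurable_fun setT f /\ exists b, has_mean P (fun w => f w ^+ 4) b.

(** The constant 1 pads products of fewer than four coordinates, so that one integrability lemma
    covers them all. *)
Lemma has_moment4_cst c : has_moment4 (fun=> c).
Proof. by split; last by exists (c ^+ 4); exact: has_mean_cst. Qed.

(** The inequality [|u v| <= (u^2 + v^2) / 2] is applied to [(a b, c e)] and then to the pairs of
    squares. *)
Lemma norm_prod4_le (a b c e : R) :
  `|a * b * c * e| <= a ^+ 4 + b ^+ 4 + c ^+ 4 + e ^+ 4.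
Proof.
have h2 (u v : R) : `|u * v| <= (u ^+ 2 + v ^+ 2) / 2.
  have := sqr_ge0 (u + v); have := sqr_ge0 (u - v).
  by rewrite ler_norml => h1 h2; apply/andP; split; lra.
have := h2 (a * b) (c * e); rewrite mulrA.
have := le_trans (ler_norm _) (h2 (a ^+ 2) (b ^+ 2)).
have := le_trans (ler_norm _) (h2 (c ^+ 2) (e ^+ 2)).
rewrite -!exprMn -!exprM /= => hce hab h.
have a4 r : 0 <= r ^+ 4 :> R by rewrite (exprM r 2 2) sqr_ge0.
by have := a4 a; have := a4 b; have := a4 c; have := a4 e; lra.
Qed.

Lemma has_mean_prod4 f1 f2 f3 f4 :
  has_moment4 f1 -> has_moment4 f2 -> has_moment4 f3 -> has_moment4 f4 ->
  exists b, has_mean P (fun w => f1 w * f2 w * f3 w * f4 w) b.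
Proof.
move=> [m1 [b1 h1]] [m2 [b2 h2]] [m3 [b3 h3]] [m4 [b4 h4]].
apply: (le_has_mean (has_meanD (has_meanD (has_meanD h1 h2) h3) h4)).
  by do 3 (apply: measurable_funM => //).
by move=> w; exact: norm_prod4_le.
Qed.
End fourth_moments.

Section task.
Context {R : realType} {d d' : measure_display} {T : measurableType d}
  {Om : measurableType d'} {p : nat}.
Variable M : meta_regression R T Om p.
Variable g : T.
Hypothesis hx4 : forall k : 'I_p,
  (data_law M g).-integrable setT (fun w => (feature M w k 0 ^+ 4)%:E).

Let P := data_law M g.
Let x := feature M.
Let e := noise M.
Let th0 := task_param M g.
Let s2 := noise_sd M g ^+ 2.
Implicit Types (th v : 'cV[R]_p) (C : 'M[R]_p).

Let mx_ k : measurable_fun setT (fun w => x w k 0).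
Proof.
have /measurable_fun_tnthP/(_ k) := measurable_feature M.
by apply: eq_measurable_fun => w _ /=; rewrite tnth_mktuple.
Qed.

Let moment4 k : has_moment4 P (fun w => x w k 0).
Proof. by split; [exact: mx_ | eexists; exact: integrable_has_mean (hx4 k)]. Qed.

Let X : {mfun Om >-> p.-tuple R} := HB.pack (fun w => vtuple (x w))
  (isMeasurableFun.Build _ _ _ _ (fun w => vtuple (x w)) (measurable_feature M)).

Let E : {mfun Om >-> R} := HB.pack e
  (isMeasurableFun.Build _ _ _ _ e (measurable_noise M)).

(** The variance equation lives in the extended reals; for a nonnegative integrand a finite value
    already gives integrability. *)
Lemma noise_sqr_mean : has_mean P (fun w => e w ^+ 2) s2.
Proof.
have := noise_variance M g; rewrite /variance !unlock.
have -> : fine (\int[data_law M g]_w (noise M w)%:E)%E = 0.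
  by have := noise_mean M g; rewrite unlock => ->.
have -> : (noise M \- cst 0) * (noise M \- cst 0) = fun w => e w ^+ 2.
  by apply/funext => w; rewrite /GRing.mul /= subr0 expr2.
move=> Ve; split; last exact: Ve.
have me : measurable_fun setT (fun w => (e w ^+ 2)%:E).
  by apply/measurable_EFinP; apply: measurable_funX; exact: measurable_noise.
apply/integrableP; split => //.
under eq_integral do rewrite gee0_abs ?lee_fin ?sqr_ge0 //.
by rewrite Ve ltry.
Qed.

(** The value is assumed; integrability follows from [|e| <= e^2 + 1]. *)
Lemma noise_has_mean0 : has_mean P e 0.
Proof.
have [b [he _]] : exists b, has_mean P e b.
  apply: (le_has_mean (has_meanD noise_sqr_mean (has_mean_cst P 1))).
    exact: measurable_noise.
  by move=> w; rewrite ler_norml; apply/andP; split; nra.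
by split => //; have := noise_mean M g; rewrite unlock.
Qed.

(** Laws and independence are stated for tuples, so functions of a feature vector have to factor
    through this inverse of [vtuple]. *)
Definition vec_of_tuple (t : p.-tuple R) : 'cV[R]_p := \col_k tnth t k.

Lemma vtupleK v : vec_of_tuple (vtuple v) = v.
Proof. by apply/matrixP => k j; rewrite ord1 mxE tnth_mktuple. Qed.

Lemma mul_noise_mean (f : p.-tuple R -> R) a : measurable_fun setT f ->
  has_mean P (fun w => f (vtuple (x w))) a ->
  has_mean P (fun w => f (vtuple (x w)) * e w) 0.
Proof.
move=> mf fa; have mid : measurable_fun setT (@idfun R).
  exact: measurable_id.
have := has_mean_indepM (X := X) (Y := E) (feature_noise_indep M g) mf mid
  fa noise_has_mean0.
by rewrite mulr0.
Qed.

Lemma mul_noise_sqr_mean (f : p.-tuple R -> R) a : measurable_fun setT f ->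
  has_mean P (fun w => f (vtuple (x w))) a ->
  has_mean P (fun w => f (vtuple (x w)) * e w ^+ 2) (a * s2).
Proof.
move=> mf fa.
have msqr : measurable_fun setT (fun r : R => r ^+ 2) by exact: exprn_measurable.
exact: (has_mean_indepM (X := X) (Y := E) (feature_noise_indep M g) mf msqr
  fa noise_sqr_mean).
Qed.

Lemma Qmx_mean : mx_mean P (fun w => x w *m (x w)^T) (Qmx M g).
Proof.
apply: mx_mean_mexp => i j.
have [b [h _]] := has_mean_prod4 (moment4 i) (moment4 j)
  (has_moment4_cst P 1) (has_moment4_cst P 1).
by apply: eq_integrable h => // w _ /=; rewrite !mulr1 !mxE big_ord1 !mxE.
Qed.

Lemma Qmx_sym : (Qmx M g)^T = Qmx M g.
Proof.
apply/matrixP => i j; rewrite !mxE; congr (fine 'E_(_)[_]%E).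
by apply/funext => w; rewrite !mxE !big_ord1 !mxE mulrC.
Qed.

Lemma Qmx_ge0 v : 0 <= wnorm2 (Qmx M g) v.
Proof.
apply: (has_mean_ge0 (mx_mean_mulr v (mx_mean_mull v^T Qmx_mean) 0 0)) => w.
by rewrite -[X in 0 <= X]/(wnorm2 _ v) wnorm2_rank1 sqr_ge0.
Qed.

Lemma mx_mean_feature4 C :
  mx_mean P (fun w => x w *m (x w)^T *m C *m x w *m (x w)^T)
    (mexp P (fun w => x w *m (x w)^T *m C *m x w *m (x w)^T)).
Proof.
apply: mx_mean_mexp => i j.
have [b h] : exists b,
    has_mean P (fun w => x w i 0 * bform C (x w) (x w) * x w j 0) b.
  pose h k l := has_mean_prod4 (moment4 i) (moment4 k) (moment4 l) (moment4 j).
  (* The means of the monomials are picked by choice, since only the integrability of their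
     combination is wanted. *)
  pose hb k l := projT2 (cid (h k l)).
  eexists; apply: has_meanW (erefl _); first exact: (has_mean_sum (index_enum 'I_p)
    (fun k => has_mean_sum (index_enum 'I_p)
      (fun l => has_meanZ (C k l) (hb k l)))).
  move=> w; rewrite /bform /= -mulmxA mxE mulr_sumr mulr_suml.
  apply: eq_bigr => k _; rewrite !mxE mulr_sumr mulr_sumr mulr_suml.
  by apply: eq_bigr => l _; ring.
apply: eq_integrable (h.1) => // w _ /=; congr (_%:E).
by rewrite outer_sandwich !mxE big_ord1 mxE mulrA [_ * bform _ _ _]mulrC.
Qed.

Lemma has_mean_feature3 C v :
  exists b, has_mean P (fun w => bform C (x w) (x w) * dotp v (x w)) b.
Proof.
pose h k l m := has_mean_prod4 (moment4 k) (moment4 l) (moment4 m)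
  (has_moment4_cst P 1).
pose hb k l m := projT2 (cid (h k l m)).
eexists; apply: has_meanW (erefl _); first exact: (has_mean_sum (index_enum 'I_p)
  (fun k => has_mean_sum (index_enum 'I_p) (fun l => has_mean_sum
    (index_enum 'I_p) (fun m => has_meanZ (C k l * v m 0) (hb k l m))))).
move=> w; rewrite /bform -mulmxA mxE mulr_suml /=.
apply: eq_bigr => k _; rewrite !mxE mulr_sumr mulr_suml.
apply: eq_bigr => l _; rewrite dotpE mulr_sumr.
by apply: eq_bigr => m _; ring.
Qed.

Lemma has_mean_feature1 v : exists b, has_mean P (fun w => dotp v (x w)) b.
Proof.
pose h k := has_mean_prod4 (moment4 k) (has_moment4_cst P 1)
  (has_moment4_cst P 1) (has_moment4_cst P 1).
pose hb k := projT2 (cid (h k)).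
eexists; apply: has_meanW (erefl _); first exact: (has_mean_sum (index_enum 'I_p)
  (fun k => has_meanZ (v k 0) (hb k))).
by move=> w; rewrite dotpE; apply: eq_bigr => k _; ring.
Qed.

(** The direction [u_i] as a function of one observation, so that its moments transfer from the
    generic draw to the sample and independence of observations applies. *)
Definition sgd_dir th (z : p.-tuple R * R) : 'cV[R]_p :=
  vec_of_tuple z.1 *m (vec_of_tuple z.1)^T *m th - z.2 *: vec_of_tuple z.1.

Let mtnth k : measurable_fun setT (fun t : p.-tuple R => tnth t k).
Proof. exact: measurable_tnth. Qed.

Let mdotp v : measurable_fun setT (fun t => dotp v (vec_of_tuple t)).
Proof.
rewrite (_ : (fun t => _) = fun t => \sum_(k < p) v k 0 * tnth t k).
  by apply: measurable_sum => k; apply: measurable_funM.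
by apply/funext => t; rewrite dotpE; apply: eq_bigr => k _; rewrite mxE.
Qed.

Let mbform d1 (T1 : measurableType d1) C (F G : T1 -> 'cV[R]_p) :
  (forall k, measurable_fun setT (fun z => F z k 0)) ->
  (forall k, measurable_fun setT (fun z => G z k 0)) ->
  measurable_fun setT (fun z => bform C (F z) (G z)).
Proof.
move=> mF mG.
rewrite (_ : (fun z => _) =
    fun z => \sum_i \sum_j C i j * (F z i 0 * G z j 0)).
  apply: measurable_sum => i; apply: measurable_sum => j.
  by apply: measurable_funM; [exact: measurable_cst | exact: measurable_funM].
by apply/funext => z; rewrite bform_sum.
Qed.

Let mvec k : measurable_fun setT (fun t : p.-tuple R => vec_of_tuple t k 0).
Proof. by under eq_fun do rewrite mxE; exact: mtnth. Qed.

Lemma sgd_dirE th z : sgd_dir th z =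
  (dotp th (vec_of_tuple z.1) - z.2) *: vec_of_tuple z.1.
Proof. by rewrite /sgd_dir outer_mulmx scalerBl. Qed.

Lemma measurable_sgd_dir th k : measurable_fun setT (fun z => sgd_dir th z k 0).
Proof.
under eq_fun do rewrite sgd_dirE mxE.
apply: measurable_funM; last exact: (measurableT_comp (mvec k) measurable_fst).
apply: measurable_funB; last exact: measurable_snd.
exact: (measurableT_comp (mdotp th) measurable_fst).
Qed.

Lemma measurable_wnorm2_sgd_dir C th :
  measurable_fun setT (fun z => wnorm2 C (sgd_dir th z)).
Proof. by apply: mbform => k; exact: measurable_sgd_dir. Qed.

Let y := response M g.

Lemma responseE w : y w = dotp th0 (x w) + e w. Proof. by []. Qed.

Let mZ : measurable_fun setT (fun w => (vtuple (x w), y w)).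
Proof.
apply: measurable_fun_pair; first exact: measurable_feature.
apply: measurable_funD; last exact: measurable_noise.
rewrite (_ : (fun w => _) =
    fun w => dotp th0 (vec_of_tuple (vtuple (x w)))); last first.
  by apply/funext => w; rewrite vtupleK.
exact: (measurableT_comp (mdotp th0) (measurable_feature M)).
Qed.

Let Z : {mfun Om >-> (p.-tuple R * R)%type} :=
  HB.pack (fun w => (vtuple (x w), y w))
    (isMeasurableFun.Build _ _ _ _ (fun w => (vtuple (x w), y w)) mZ).

Let mO i : measurable_fun setT
  (fun w => (vtuple (obs_feature M i w), obs_response M i w)).
Proof.
apply: measurable_fun_pair; first exact: measurable_obs_feature.
exact: measurable_obs_response.
Qed.

Let O i : {mfun Om >-> (p.-tuple R * R)%type} :=
  HB.pack (fun w => (vtuple (obs_feature M i w), obs_response M i w))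
    (isMeasurableFun.Build _ _ _ _
      (fun w => (vtuple (obs_feature M i w), obs_response M i w)) (mO i)).

Lemma sgd_dir_draw th w :
  sgd_dir th (Z w) = (dotp (th - th0) (x w) - e w) *: x w.
Proof.
rewrite sgd_dirE /= vtupleK responseE; congr (_ *: _).
by rewrite !dotp_bform bformDl bformNl; ring.
Qed.

Lemma noise_feature_mean : mx_mean P (fun w => e w *: x w) 0.
Proof.
move=> k j; rewrite ord1 mxE; have [b hb] := has_mean_feature1 (delta_mx k 0).
have /(mul_noise_mean (mvec k)) h :
    has_mean P (fun w => vec_of_tuple (vtuple (x w)) k 0) b.
  apply: (has_meanW hb) => // w.
  by rewrite vtupleK dotp_bform bform_delta_l mul1mx.
by apply: (has_meanW h) => // w; rewrite vtupleK mxE mulrC.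
Qed.

Lemma sgd_dir_draw_mean th :
  mx_mean P (fun w => sgd_dir th (Z w)) (Qmx M g *m (th - th0)).
Proof.
apply: (mx_meanW (mx_meanB (mx_mean_mulr (th - th0) Qmx_mean) noise_feature_mean)).
  by move=> w; rewrite sgd_dir_draw outer_mulmx scalerBl.
by rewrite subr0.
Qed.

Let B := mexp P (fun w => x w *m (x w)^T *m Qmx M g *m x w *m (x w)^T).
(** The second moment [E ||u_i||_Q^2]: a signal part through the fourth moment matrix [B], and a
    noise part. *)
Let S2 th := wnorm2 B (th - th0) + s2 * \tr (Qmx M g *m Qmx M g).

(** The form equals [(x^T Q x) (v^T x - e)^2]. After expansion, the term linear in [e] vanishes by
    independence and centring, and the term in [e^2] uses [E[x^T Q x] = tr(Q^2)]. *)
Lemma sgd_dir_draw_wnorm2_mean th :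
  has_mean P (fun w => wnorm2 (Qmx M g) (sgd_dir th (Z w))) (S2 th).
Proof.
set Q := Qmx M g; set v := th - th0.
have h1 : has_mean P (fun w => bform Q (x w) (x w) * dotp v (x w) ^+ 2)
    (wnorm2 B v).
  apply: (has_meanW (mx_mean_mulr v (mx_mean_mull v^T (mx_mean_feature4 Q)) 0 0)).
    move=> w; rewrite -[LHS]/(wnorm2 _ v) outer_sandwich wnorm2Z.
    by rewrite wnorm2_rank1.
  by [].
have mQ : measurable_fun setT (fun t => bform Q (vec_of_tuple t) (vec_of_tuple t)).
  exact: mbform.
have h2 : has_mean P (fun w => bform Q (x w) (x w) * dotp v (x w) * e w) 0.
  have [b hb] := has_mean_feature3 Q v.
  have mf : measurable_fun setT (fun t =>
      bform Q (vec_of_tuple t) (vec_of_tuple t) * dotp v (vec_of_tuple t)) by exact: measurable_funM.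
  apply: (has_meanW (mul_noise_mean mf (a := b) _)) => //.
    by apply: (has_meanW hb) => // w; rewrite vtupleK.
  by move=> w; rewrite vtupleK.
have h3 : has_mean P (fun w => bform Q (x w) (x w) * e w ^+ 2)
    (\tr (Q *m Q) * s2).
  have /(mul_noise_sqr_mean mQ) h : has_mean P (fun w =>
      bform Q (vec_of_tuple (vtuple (x w))) (vec_of_tuple (vtuple (x w))))
      (\tr (Q *m Q)).
    apply: (has_meanW (has_mean_trace (mx_mean_mull Q Qmx_mean))) => // w.
    by rewrite vtupleK bform_trace.
  by apply: (has_meanW h) => // w; rewrite vtupleK.
apply: (has_meanW (has_meanD (has_meanB h1 (has_meanZ 2 h2)) h3)).
  move=> w; rewrite sgd_dir_draw wnorm2E bformZl bformZr -/v; ring.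
by rewrite /S2 -/v -/Q; ring.
Qed.

(** * From the generic draw to the observed sample *)

Let obs_same_law i : same_law P (O i) Z. Proof. exact: obs_law. Qed.

Lemma sgd_dir_obs_mean th i :
  mx_mean P (fun w => sgd_dir th (O i w)) (Qmx M g *m (th - th0)).
Proof.
move=> k j; rewrite (ord1 j).
exact: (has_mean_same_law (measurable_sgd_dir th k) (obs_same_law i)
  (sgd_dir_draw_mean th k 0)).
Qed.

Lemma sgd_dir_obs_wnorm2_mean th i :
  has_mean P (fun w => wnorm2 (Qmx M g) (sgd_dir th (O i w))) (S2 th).
Proof.
exact: (has_mean_same_law (measurable_wnorm2_sgd_dir _ th) (obs_same_law i)
  (sgd_dir_draw_wnorm2_mean th)).
Qed.

Let obs_indep2 i j : i != j -> independent2 P (O i) (O j).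
Proof.
move=> ij A C mA mC.
(* Mutual independence is used on the two indices only; the family of sets takes the value [A] at
   [i] and [C] elsewhere. *)
have := obs_indep M g (s := [:: i; j]) (A := fun k => if k == i then A else C).
rewrite /= inE ij /= !big_cons big_nil eqxx [j == i]eq_sym (negbTE ij) mule1.
move=> <- //; last by move=> k; case: ifP.
congr (P _); apply/seteqP; split => w.
  move=> [Aw Cw] k /=; rewrite !inE => /orP[]/eqP ->; first by rewrite eqxx.
  by rewrite eq_sym (negbTE ij).
move=> h; split.
  by have := h i; rewrite /= !inE eqxx => /(_ isT).
by have := h j; rewrite /= !inE eqxx orbT [j == i]eq_sym (negbTE ij) => /(_ isT).
Qed.

Let q th := bform (Qmx M g) (Qmx M g *m (th - th0)) (Qmx M g *m (th - th0)).

(** By independence the mean of the outer product of two directions is the outer product of their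
    means; the trace form then gives the value. *)
Lemma sgd_dir_obs_bform_mean th i j : i != j ->
  has_mean P (fun w => bform (Qmx M g) (sgd_dir th (O i w)) (sgd_dir th (O j w)))
    (q th).
Proof.
move=> ij; have h : mx_mean P
    (fun w => sgd_dir th (O j w) *m (sgd_dir th (O i w))^T)
    ((Qmx M g *m (th - th0)) *m (Qmx M g *m (th - th0))^T).
  move=> k l; apply: (has_meanW (has_mean_indepM (obs_indep2 ij)
    (measurable_sgd_dir th l) (measurable_sgd_dir th k)
    (sgd_dir_obs_mean th i l 0) (sgd_dir_obs_mean th j k 0))).
    by move=> w; rewrite [RHS]mxE big_ord1 [_^T _ _]mxE mulrC.
  by rewrite [RHS]mxE big_ord1 [_^T _ _]mxE mulrC.
apply: (has_meanW (has_mean_trace (mx_mean_mull (Qmx M g) h))).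
  by move=> w; rewrite bform_trace.
by rewrite /q bform_trace.
Qed.

Lemma Smx_wnorm2_step alpha v :
  wnorm2 (Smx M alpha g) v = wnorm2 (Qmx M g) ((1%:M - alpha *: Qmx M g) *m v).
Proof.
rewrite /Smx -{1}(_ : (1%:M - alpha *: Qmx M g)^T = 1%:M - alpha *: Qmx M g).
  exact: wnorm2_congr.
by rewrite linearB linearZ /= trmx1 Qmx_sym.
Qed.

Lemma Smx_wnorm2 alpha v : wnorm2 (Smx M alpha g) v =
  wnorm2 (Qmx M g) v - 2 * alpha * bform (Qmx M g) v (Qmx M g *m v) +
  alpha ^+ 2 * bform (Qmx M g) (Qmx M g *m v) (Qmx M g *m v).
Proof.
rewrite Smx_wnorm2_step mulmxBl mul1mx -scalemxAl.
rewrite wnorm2_sub ?Qmx_sym // bformZr [wnorm2 _ (alpha *: _)]wnorm2E.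
by rewrite bformZl bformZr; ring.
Qed.

Lemma Qmx3_wnorm2 v : wnorm2 (Qmx M g *m Qmx M g *m Qmx M g) v =
  bform (Qmx M g) (Qmx M g *m v) (Qmx M g *m v).
Proof. by rewrite -{1}Qmx_sym wnorm2_congr. Qed.

Lemma sgd_wnorm2_mean alpha N th : (0 < N)%N ->
  has_mean P (fun w => wnorm2 (Qmx M g) (sgd M alpha N th w - th0))
    (wnorm2 (Amx M alpha N g) (th - th0) +
     alpha ^+ 2 / N%:R * (s2 * \tr (Qmx M g *m Qmx M g))).
Proof.
move=> N0; have N0R : N%:R != 0 :> R by rewrite pnatr_eq0 -lt0n.
set Q := Qmx M g; set v := th - th0.
pose V w := \sum_(i < N) sgd_dir th (O i w).
have sgdE w : sgd M alpha N th w - th0 = v - (alpha / N%:R) *: V w.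
  rewrite /sgd addrAC; congr (_ - _ *: _); apply: eq_bigr => i _.
  by rewrite /sgd_dir /= vtupleK.
have hV : has_mean P (fun w => bform Q v (V w)) (N%:R * bform Q v (Q *m v)).
  have h := mx_mean_mull (v^T *m Q)
    (mx_mean_sum (index_enum 'I_N) (fun i : 'I_N => sgd_dir_obs_mean th i)).
  apply: (has_meanW (h 0 0)) => //.
  by rewrite sumr_const card_ord -scaler_nat -scalemxAr mxE.
have hVV : has_mean P (fun w => wnorm2 Q (V w))
    (N%:R * (N%:R * q th + (S2 th - q th))).
  (* Every pair of indices is charged the off-diagonal value [q th], and the N diagonal pairs
     receive the correction [S2 th - q th]. *)
  have h (i j : 'I_N) : has_mean P
      (fun w => bform Q (sgd_dir th (O i w)) (sgd_dir th (O j w)))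
      (q th + (if j == i then S2 th - q th else 0)).
    have [->|ij] := eqVneq j i.
      by apply: (has_meanW (sgd_dir_obs_wnorm2_mean th i)) => //; ring.
    rewrite addr0; apply: sgd_dir_obs_bform_mean.
    by rewrite eq_sym.
  apply: (has_meanW (has_mean_sum (index_enum 'I_N)
    (fun i => has_mean_sum (index_enum 'I_N) (fun j => h i j)))).
    move=> w; rewrite wnorm2E /V bform_suml; apply: eq_bigr => i _.
    by rewrite bform_sumr.
  under eq_bigr => i _ do
    rewrite big_split sumr_const card_ord -big_mkcond big_pred1_eq.
  by rewrite sumr_const card_ord -[q th *+ N]mulr_natl -[_ *+ N]mulr_natl.
apply: (has_meanW (has_meanD (has_meanB (has_mean_cst P (wnorm2 Q v))
  (has_meanZ (2 * (alpha / N%:R)) hV)) (has_meanZ ((alpha / N%:R) ^+ 2) hVV))).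
  move=> w; rewrite sgdE [RHS]wnorm2_sub ?Qmx_sym // bformZr.
  by rewrite !wnorm2E bformZl bformZr; ring.
(* Since [q th] is [||v||^2] weighted by [Q^3], its [alpha^2] multiple completes [S(alpha)], and
   [alpha^2 / N] times the correction yields the rest of [A(alpha)] and the noise trace. *)
rewrite /Amx wnorm2D wnorm2Z wnorm2B Smx_wnorm2 Qmx3_wnorm2 -/Q -/v.
rewrite /S2 /q -/Q -/v -/B; field.
exact: N0R.
Qed.

(** * The risk as a quadratic function, and its gradient *)

Lemma riskE v : risk M g v = 2^-1 * (wnorm2 (Qmx M g) (v - th0) + s2).
Proof.
rewrite /risk; congr (_ * _); apply: fine_expectation; set u := v - th0.
have h1 := mx_mean_mulr u (mx_mean_mull u^T Qmx_mean) 0 0.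
have h2 := mx_mean_mull u^T noise_feature_mean 0 0.
apply: (has_meanW (has_meanD (has_meanB h1 (has_meanZ 2 h2)) noise_sqr_mean)).
  move=> w; rewrite -[X in X - _ + _]/(wnorm2 _ u) wnorm2_rank1.
  rewrite -scalemxAr mxE -/(dotp u (x w)) -/y responseE.
  by rewrite /u !dotp_bform bformDl bformNl; ring.
by rewrite mulmx0 [X in 2 * X]mxE mulr0 subr0.
Qed.

(** Along a basis vector the difference quotient of the quadratic risk is exactly affine in the
    increment, so the limit is its constant coefficient. *)
Lemma gradient_risk th : gradient (risk M g) th = Qmx M g *m (th - th0).
Proof.
apply/matrixP => k j; rewrite ord1 mxE -bform_delta_l.
set u := delta_mx k 0; set Q := Qmx M g; apply: cvg_lim => //.
have quot (h : R) : h != 0 ->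
    bform Q u (th - th0) + h * (2^-1 * wnorm2 Q u) =
    h^-1 * (risk M g (h *: u + th) - risk M g th).
  move=> h0; rewrite !riskE -/Q -(addrA (h *: u)); move: (th - th0) => v.
  rewrite !wnorm2E !(bformDl, bformDr, bformZl, bformZr).
  by rewrite (bformC v u Qmx_sym); field.
apply: (@cvg_trans _ ((fun h : R => bform Q u (th - th0) +
    h * (2^-1 * wnorm2 Q u)) @ 0^')).
  apply: near_eq_cvg; near=> h; apply: quot.
  by near: h; exact: nbhs_dnbhs_neq.
suff : (fun h : R => bform Q u (th - th0) + h * (2^-1 * wnorm2 Q u)) @ 0^' -->
    bform Q u (th - th0) + 0 * (2^-1 * wnorm2 Q u) by rewrite mul0r addr0.
apply: cvgD; first exact: cvg_cst.
by apply: cvgMl; exact: cvg_within.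
Unshelve. all: by end_near.
Qed.

End task.

(** * Averaging over the tasks *)

Section meta_losses.
Context {R : realType} {d d' : measure_display} {T : measurableType d}
  {Om : measurableType d'} {p : nat}.
Variables (M : meta_regression R T Om p) (alpha beta : R).
Hypothesis hx4 : forall (g : T) (k : 'I_p),
  (data_law M g).-integrable setT (fun w => (feature M w k 0 ^+ 4)%:E).
Hypothesis hsigma :
  (task_law M).-integrable setT (fun g => (noise_sd M g ^+ 2)%:E).
Hypothesis hQ : forall th : 'cV[R]_p, (task_law M).-integrable setT
  (fun g => (wnorm2 (Qmx M g) (th - task_param M g))%:E).
Hypothesis hA : forall (N : nat) (th : 'cV[R]_p), (0 < N)%N ->
  (task_law M).-integrable setT
    (fun g => (wnorm2 (Amx M alpha N g) (th - task_param M g))%:E).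
Hypothesis hbeta : {ae task_law M, forall g, opnorm (Qmx M g) <= beta}.

Let P := task_law M.
Let err (W : T -> 'M[R]_p) (th : 'cV[R]_p) g : R :=
  wnorm2 (W g) (th - task_param M g).
Let merr W (th : 'cV[R]_p) : R := fine 'E_P[err W th]%E.
Let s2 : R := fine 'E_P[fun g => (noise_sd M g ^+ 2)%R]%E.
Let trQ2 g := \tr (Qmx M g *m Qmx M g).
Let t : R := fine 'E_P[fun g => (noise_sd M g ^+ 2 * trQ2 g)%R]%E.
Implicit Types th : 'cV[R]_p.

Let s2_mean : has_mean P (fun g => noise_sd M g ^+ 2) s2.
Proof. exact: integrable_has_mean. Qed.

Let errQ_mean th : has_mean P (err (Qmx M) th) (merr (Qmx M) th).
Proof. exact: integrable_has_mean (hQ th). Qed.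

Let errA_mean N th : (0 < N)%N ->
  has_mean P (err (Amx M alpha N) th) (merr (Amx M alpha N) th).
Proof. move=> N0; exact: integrable_has_mean (hA th N0). Qed.

Let excess th g := wnorm2 (mexp (data_law M g)
       (fun w => feature M w *m (feature M w)^T *m Qmx M g
                 *m feature M w *m (feature M w)^T)
     - Qmx M g *m Qmx M g *m Qmx M g) (th - task_param M g).

Let err_AmxE N th g : err (Amx M alpha N) th g =
  err (Smx M alpha) th g + N%:R^-1 * (alpha ^+ 2 * excess th g).
Proof. by rewrite /err /Amx wnorm2D wnorm2Z /excess; ring. Qed.

(* [S = 2 A_2 - A_1], since [A_N] is affine in [1/N]. *)
Let errS_mean th : has_mean P (err (Smx M alpha) th) (merr (Smx M alpha) th).
Proof.
apply: integrable_has_mean.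
have [h _] := has_meanB (has_meanZ 2 (@errA_mean 2 th isT)) (@errA_mean 1 th isT).
by apply: eq_integrable h => // g _ /=; rewrite !err_AmxE; congr (_%:E); field.
Qed.

(** This is the difference of the errors for [A] at N = 1 and for [S]. The factor [alpha ^+ 2] stays
    inside because [alpha] may be zero. *)
Let excess_mean th : exists c, has_mean P (fun g => alpha ^+ 2 * excess th g) c.
Proof.
eexists; apply: (has_meanW (has_meanB (@errA_mean 1 th isT) (errS_mean th))) => //.
by move=> g; rewrite err_AmxE invr1 mul1r addrAC subrr add0r.
Qed.

(** The almost sure bound on [Q] bounds its squared trace by [p beta^2], and the noise variance is
    integrable. Measurability of the trace comes from the entries of [Q], recovered from the
    errors. *)
Let noise_trace_mean : has_mean P (fun g => noise_sd M g ^+ 2 * trQ2 g) t.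
Proof.
have mQ : mx_mean P (Qmx M) (mexp P (Qmx M)).
  exact: (mx_mean_weight (th_ := task_param M) (Qmx_sym M) hQ).
have mtr : measurable_fun setT trQ2.
  apply: measurable_sum => i; under eq_fun do rewrite mxE.
  by apply: measurable_sum => j; apply: measurable_funM;
    exact: has_mean_measurable (mQ _ _).
have [b hb] : exists b, has_mean P (fun g => noise_sd M g ^+ 2 * trQ2 g) b.
  apply: (has_mean_mul_ae_bounded (c := beta ^+ 2 *+ p) s2_mean mtr).
  - by move=> g; exact: sqr_ge0.
  - by move=> g; apply: trace_sqr_ge0; exact: Qmx_sym.
  - by apply: filterS hbeta => g; apply: trace_sqr_le; exact: Qmx_sym.
exact: integrable_has_mean hb.1.
Qed.

Let Smx_ge0 g v : 0 <= wnorm2 (Smx M alpha g) v.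
Proof. by rewrite Smx_wnorm2_step Qmx_ge0. Qed.

Let Smx_sym g : (Smx M alpha g)^T = Smx M alpha g.
Proof.
rewrite /Smx !trmx_mul Qmx_sym linearB linearZ /= trmx1 Qmx_sym.
by rewrite mulmxA.
Qed.

Lemma drs_lossE th : drs_loss M th = (2^-1 * (merr (Qmx M) th + s2))%:E.
Proof.
apply: has_mean_expectation.
apply: (has_meanW (has_meanZ 2^-1 (has_meanD (errQ_mean th) s2_mean))) => // g.
by rewrite riskE.
Qed.

(** A gradient step turns the error vector [v] into [(I - alpha Q) v], whose [Q]-seminorm is the
    [S(alpha)]-seminorm of [v]. *)
Lemma maml_lossE th :
  maml_loss M alpha th = (2^-1 * (merr (Smx M alpha) th + s2))%:E.
Proof.
apply: has_mean_expectation.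
apply: (has_meanW (has_meanZ 2^-1 (has_meanD (errS_mean th) s2_mean))) => // g.
rewrite riskE // gradient_risk // /err Smx_wnorm2_step.
by rewrite mulmxBl mul1mx -scalemxAl addrAC.
Qed.

Lemma sgd_lossE N th : (0 < N)%N -> sgd_loss M alpha N th =
  (2^-1 * (merr (Amx M alpha N) th + (alpha ^+ 2 / N%:R * t + s2)))%:E.
Proof.
move=> N0; rewrite /sgd_loss.
have h := has_meanZ 2^-1 (has_meanD (errA_mean th N0)
  (has_meanD (has_meanZ (alpha ^+ 2 / N%:R) noise_trace_mean) s2_mean)).
rewrite -h.2; apply: eq_integral => g _; apply: has_mean_expectation.
apply: (has_meanW (has_meanZ 2^-1 (has_meanD
  (sgd_wnorm2_mean (hx4 g) alpha th N0) (has_mean_cst _ (noise_sd M g ^+ 2))))).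
  by move=> w; rewrite riskE.
by rewrite addrA.
Qed.

Lemma sgd_loss_cvg th :
  (fun N : nat => sgd_loss M alpha N th) @ \oo --> maml_loss M alpha th.
Proof.
have [c hc] := excess_mean th.
pose a := 2^-1 * (merr (Smx M alpha) th + s2).
(* The closed form of the SGD loss needs a nonempty sample, so the sequence is shifted by one;
   [harmonic N] is then the reciprocal of the sample size [N.+1]. *)
rewrite maml_lossE -/a -cvg_shiftS /=.
rewrite (_ : (fun N => _) =
    EFin \o (fun N => a + 2^-1 * (c + alpha ^+ 2 * t) * harmonic N)).
  apply: cvg_EFin; first by near=> N.
  rewrite -[X in _ --> X]addr0; apply: cvgD; first exact: cvg_cst.
  rewrite -[X in _ --> X](mulr0 (2^-1 * (c + alpha ^+ 2 * t))).
  by apply: cvgMr; exact: cvg_harmonic.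
apply/funext => N; rewrite sgd_lossE //=; congr (_%:E).
have -> : merr (Amx M alpha N.+1) th = merr (Smx M alpha) th + N.+1%:R^-1 * c.
  apply: fine_expectation.
  apply: (has_meanW (has_meanD (errS_mean th) (has_meanZ N.+1%:R^-1 hc))) => //.
by rewrite /a; ring.
Unshelve. all: by end_near.
Qed.

Lemma minimizes_drs_loss : mexp P (Qmx M) \in unitmx ->
  minimizes (drs_loss M) (theta_drs M).
Proof.
move=> uQ th; rewrite !drs_lossE lee_fin ler_wpM2l ?invr_ge0 // lerD2r.
by have := weighted_least_squares_min (Qmx_sym M) hQ
  (fun g => Qmx_ge0 (hx4 g)) uQ (errQ_mean _) (errQ_mean th).
Qed.

Lemma minimizes_maml_loss : mexp P (Smx M alpha) \in unitmx ->
  minimizes (maml_loss M alpha) (theta_maml M alpha).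
Proof.
move=> uS th; rewrite !maml_lossE lee_fin ler_wpM2l ?invr_ge0 // lerD2r.
by have := weighted_least_squares_min Smx_sym (fun th => (errS_mean th).1)
  Smx_ge0 uS (errS_mean _) (errS_mean th).
Qed.

Lemma maml_loss_le_drs_loss th : 0 < alpha -> alpha <= 1 / beta ->
  (maml_loss M alpha th <= drs_loss M th)%E.
Proof.
(* Positivity of [beta] is forced by [0 < alpha <= 1 / beta]. *)
move=> a0 ab; have b0 : 0 < beta.
  by have := lt_le_trans a0 ab; rewrite div1r invr_gt0.
rewrite maml_lossE drs_lossE lee_fin ler_wpM2l ?invr_ge0 // lerD2r.
apply: (ae_has_mean_le (errS_mean th) (errQ_mean th)).
- by move=> g; exact: Smx_ge0.
- by move=> g; exact: Qmx_ge0.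
apply: filterS hbeta => g Qb; apply: wnorm2_step_le Qb => //.
- exact: Qmx_sym.
- exact: ltW.
- by rewrite -ler_pdivlMr.
Qed.

End meta_losses.

Theorem theorem5 (R : realType) (d d' : measure_display)
    (T : measurableType d) (Om : measurableType d') (p : nat)
    (M : meta_regression R T Om p) (alpha beta : R)
    (hx4 : forall (g : T) (k : 'I_p),
       (data_law M g).-integrable setT (fun w => (feature M w k 0 ^+ 4)%:E))
    (hsigma : (task_law M).-integrable setT (fun g => (noise_sd M g ^+ 2)%:E))
    (hQ : forall th : 'cV[R]_p, (task_law M).-integrable setT
       (fun g => (wnorm2 (Qmx M g) (th - task_param M g))%:E))
    (hA : forall (N : nat) (th : 'cV[R]_p), (0 < N)%N ->
       (task_law M).-integrable setT
         (fun g => (wnorm2 (Amx M alpha N g) (th - task_param M g))%:E))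
    (hQinv : mexp (task_law M) (Qmx M) \in unitmx)
    (hSinv : mexp (task_law M) (Smx M alpha) \in unitmx)
    (hbeta : {ae task_law M, forall g, opnorm (Qmx M g) <= beta}) :
  [/\ equiv_loss (drs_loss M) (mean_wnorm2 M (Qmx M)),
      forall N : nat, (0 < N)%N ->
        equiv_loss (sgd_loss M alpha N) (mean_wnorm2 M (Amx M alpha N)),
      minimizes (drs_loss M) (theta_drs M) &
      [/\ forall th : 'cV[R]_p,
            (fun N : nat => sgd_loss M alpha N th) @ \oo
              --> maml_loss M alpha th,
          minimizes (maml_loss M alpha) (theta_maml M alpha) &
          0 < alpha -> alpha <= 1 / beta ->
            (maml_loss M alpha (theta_maml M alpha)
               <= drs_loss M (theta_drs M))%E]].
Proof.
have hdrs := drs_lossE hx4 hsigma hQ.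
have hsgd := sgd_lossE hx4 hsigma hQ hA hbeta.
have hmaml := minimizes_maml_loss hx4 hsigma hA hSinv.
split.
- eexists => th; rewrite hdrs mulrDr EFinD EFinM; congr (_ * _ + _)%E.
  exact/esym/(has_mean_expectation (integrable_has_mean (hQ th))).
(* The additive constant collects the noise trace and the noise variance; it depends on [N] but not
   on [th]. *)
- move=> N N0; eexists => th; rewrite hsgd // mulrDr EFinD EFinM.
  congr (_ * _ + _)%E.
  exact/esym/(has_mean_expectation (integrable_has_mean (hA N th N0))).
- exact: minimizes_drs_loss.
split => //.
- exact: sgd_loss_cvg hbeta.
(* The two minimum values are compared through the MAML loss at [theta_drs], where the pointwise
   comparison of the losses applies. *)
- move=> a0 ab; apply: le_trans (hmaml (theta_drs M)) _.
  exact: maml_loss_le_drs_loss hbeta _ _ _.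
Qed.
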